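(* Let $\mu\in L^\infty(\mathbb{D})$ with $\|\mu\|_{L^\infty(\mathbb{D})}\le1$ and let $Q=\mathscr{Q}[\mathrm{M}_\mu]$. Then $Q(z,0)=Q(0,w)=0$ for all $z,w\in\mathbb{D}$, and $Q$ solves the linear damped wave equation $$\partial_z\partial_wQ(z,w)=\frac{z^2\partial_zQ(z,w)-w^2\partial_wQ(z,w)}{zw(z-w)},\qquad(z,w)\in\mathbb{D}^2.$$
   Context: $\mathbb{D}$ is the open unit disk, $\mathrm{dA}=\mathrm{d}x\,\mathrm{d}y/\pi$, and $\langle f,g\rangle_{\mathbb{D}}=\int_{\mathbb{D}}f\bar g\,\mathrm{dA}$. $\mathrm{M}_\mu$ is the operator of multiplication by $\mu$ on $L^2(\mathbb{D})$. For a bounded operator $\mathrm{T}$ on $L^2(\mathbb{D})$, its Dirichlet operator symbol is the holomorphic function $\mathscr{Q}[\mathrm{T}](z,w)=zw\langle\mathrm{T}(\bar s_w),s_z\rangle_{\mathbb{D}}$ on $\mathbb{D}^2$, where $s_z(\zeta)=(1-\bar z\zeta)^{-1}$ and $\bar s_w$ is the complex conjugate of $s_w$. Where $zw(z-w)=0$ the equation is understood via removable singularities (equivalently, it holds after multiplication by $zw(z-w)$). *)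

(* Defs.v *)
From HB Require Import structures.
From mathcomp Require Import all_boot all_order all_algebra.
From mathcomp Require Import complex.
From mathcomp Require Import all_classical all_reals all_analysis.
From mathcomp Require Import measurable_realfun.

Set Implicit Arguments.
Unset Strict Implicit.
Unset Printing Implicit Defensive.

Import Order.TTheory GRing.Theory Num.Theory.
Import numFieldTopology.Exports numFieldNormedType.Exports.

Local Open Scope classical_set_scope.
Local Open Scope ring_scope.
Local Open Scope complex_scope.

(* MathComp-Analysis equips an abstract numFieldType, but not the concrete
   R[i], with its topology and norm. *)
Definition Cplx (R : realType) : numClosedFieldType := R[i].

Section Disk.
Context {R : realType}.
Local Notation C := (Cplx R).
Local Notation plane := (measurableTypeR R * measurableTypeR R)%type.

Definition disk : set C := [set z | `|z| < 1].

Definition of_plane (p : plane) : C := p.1 +i* p.2.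

Definition plane_disk : set plane := of_plane @^-1` disk.

Lemma plane_diskE : plane_disk = [set p : plane | p.1 ^+ 2 + p.2 ^+ 2 < 1].
Proof.
have h (x y : R) : (`|(x +i* y : R[i])| < 1) = (x ^+ 2 + y ^+ 2 < 1).
  by rewrite normc_def (ltcR _ 1) /= -[X in _ < X]sqrtr1 ltr_sqrt ?sqrtr1.
by apply/seteqP; split => -[x y]; have := h x y; rewrite /plane_disk/= => <-.
Qed.

Lemma measurable_plane_disk : measurable plane_disk.
Proof.
rewrite plane_diskE.
have -> : [set p : plane | p.1 ^+ 2 + p.2 ^+ 2 < 1] = [set: plane] `&`
    (fun p : plane => p.1 ^+ 2 + p.2 ^+ 2) @^-1` `]-oo, 1[%classic.
  by rewrite setTI; apply/seteqP; split => p /=; rewrite in_itv.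
apply: (measurable_funD (f := fun p : plane => p.1 ^+ 2)
  (g := fun p : plane => p.2 ^+ 2)) => //; exact: measurable_funX.
Qed.

Lemma invr_pi_ge0 : 0 <= (pi : R)^-1.
Proof. by rewrite invr_ge0 pi_ge0. Qed.

Definition dA : {measure set plane -> \bar R} :=
  mscale (NngNum invr_pi_ge0) (lebesgue_measure \x lebesgue_measure)%E.

Definition dA_disk : {measure set plane -> \bar R} :=
  mrestr dA measurable_plane_disk.

Definition disk_integral (f : C -> C) : C :=
  (\int[dA]_(p in plane_disk) complex.Re (f (of_plane p)))
  +i* (\int[dA]_(p in plane_disk) complex.Im (f (of_plane p))).

Definition disk_inner (f g : C -> C) : C :=
  disk_integral (fun zeta => f zeta * (g zeta)^*%R).

(* Borel measurability; every class of Lebesgue measurable functions modulo null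
   sets has such a representative. *)
Definition disk_measurable (f : C -> C) : Prop :=
  measurable_fun plane_disk (fun p => complex.Re (f (of_plane p))) /\
  measurable_fun plane_disk (fun p => complex.Im (f (of_plane p))).

(* Only the values of f on the disk matter: dA_disk is null outside it. *)
Definition Linfty_norm (f : C -> C) : \bar R :=
  Lnorm dA_disk +oo%E (fun p => (complex.Re `|f (of_plane p)|)%:E).

(* L^2 and L^oo of the disk are handled through representatives, as functions
   C -> C whose values outside the disk are irrelevant; an operator on L^2
   thus acts on functions. *)
Definition mulop (mu : C -> C) (f : C -> C) : C -> C :=
  fun zeta => mu zeta * f zeta.

Definition szego (z : C) : C -> C := fun zeta => (1 - z^* * zeta)^-1.

Definition dirichlet_symbol (T : (C -> C) -> (C -> C)) (z w : C) : C :=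
  z * w * disk_inner (T (fun zeta => (szego w zeta)^*%R)) (szego z).

Definition d_z (Q : C -> C -> C) (z w : C) : C :=
  derive1 (fun z' : C => Q z' w) z.

Definition d_w (Q : C -> C -> C) (z w : C) : C :=
  derive1 (fun w' : C => Q z w') w.

(* Holomorphy as complex (Frechet) differentiability in both variables. *)
Definition holomorphic_bidisk (Q : C -> C -> C) : Prop :=
  forall p : C * C, disk p.1 -> disk p.2 ->
    differentiable (fun q : C * C => Q q.1 q.2) p.

End Disk.

(* Main.v *)
(* With u_z(x) = 1/(1 - z conj x), the symbol is the integral against mu dA of
   the kernel (z u_z)(w u_w).  For z, w in the disk this kernel has a
   second-order Taylor expansion in (z, w) that is uniform in x, so one may
   differentiate under the integral sign; (z u_z)' = u_z^2 gives
   dz dw Q = int mu u_z^2 u_w^2, and the equation becomes the pointwise identity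
   zw(z-w) u_z^2 u_w^2 = z^2 u_z^2 (w u_w) - w^2 (z u_z) u_w^2. *)
Require Import Defs.
From HB Require Import structures.
From mathcomp Require Import all_boot all_order all_algebra.
From mathcomp Require Import complex.
From mathcomp Require Import all_classical all_reals all_analysis.
From mathcomp Require Import measurable_realfun ess_sup_inf.
From mathcomp Require Import ring.
Import Order.TTheory GRing.Theory Num.Theory.
Import numFieldTopology.Exports numFieldNormedType.Exports.
Local Open Scope classical_set_scope.
Local Open Scope ring_scope.

(** * Measurability of complex-valued functions on the disk *)

Section DiskMeasurable.
Context {R : realType}.
Local Notation C := (Cplx R).
Implicit Types f g : C -> C.
Set Implicit Arguments.
Unset Strict Implicit.

Lemma disk_measurable_cst (c : C) : disk_measurable (fun=> c).
Proof. by split; exact: measurable_cst. Qed.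

Lemma disk_measurableD f g : disk_measurable f -> disk_measurable g ->
  disk_measurable (fun x => f x + g x).
Proof.
move=> [f1 f2] [g1 g2]; split.
  have := measurable_funD f1 g1; congr measurable_fun; apply/funext => p /=.
  by case: (f _) => a b; case: (g _).
have := measurable_funD f2 g2; congr measurable_fun; apply/funext => p /=.
by case: (f _) => a b; case: (g _).
Qed.

Lemma disk_measurableM f g : disk_measurable f -> disk_measurable g ->
  disk_measurable (fun x => f x * g x).
Proof.
move=> [f1 f2] [g1 g2]; split.
  have := measurable_funB (measurable_funM f1 g1) (measurable_funM f2 g2).
  congr measurable_fun; apply/funext => p /=.
  by case: (f _) => a b; case: (g _).
have := measurable_funD (measurable_funM f1 g2) (measurable_funM f2 g1).
congr measurable_fun; apply/funext => p /=.
by case: (f _) => a b; case: (g _) => c d /=.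
Qed.

Lemma disk_measurableV f : disk_measurable f ->
  disk_measurable (fun x => (f x)^-1).
Proof.
move=> [f1 f2].
have n_ge0 (x y : R) : 0 <= x ^+ 2 + y ^+ 2 by rewrite addr_ge0 ?sqr_ge0.
(* The inverse of a + ib is (a - ib) / (a^2 + b^2). The real reciprocal is taken as the power -1,
   which on nonnegative reals is the inverse, also at 0, where both are 0. *)
have mn := measurableT_comp (measurable_powR (R := R) (-1))
  (measurable_funD (measurable_funX 2 f1) (measurable_funX 2 f2)).
split.
  have := measurable_funM f1 mn; congr measurable_fun; apply/funext => p /=.
  by case: (f _) => a b /=; rewrite powR_inv1.
have := measurable_funN (measurable_funM f2 mn).
congr measurable_fun; apply/funext => p /=.
by case: (f _) => a b /=; rewrite powR_inv1// mulNr.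
Qed.

Lemma disk_measurable_conj : disk_measurable (fun x : C => x^*%R).
Proof.
by split; [exact: measurable_funTS measurable_fst
          |exact: measurable_funN (measurable_funTS measurable_snd)].
Qed.

End DiskMeasurable.

(** * Integration over the disk against an essentially bounded factor *)

Section DiskIntegral.
Context {R : realType}.
Local Notation C := (Cplx R).
Local Notation plane := (measurableTypeR R * measurableTypeR R)%type.
Implicit Types f g : C -> C.
Set Implicit Arguments.
Unset Strict Implicit.

Lemma dA_disk_fin : (dA (@plane_disk R) < +oo)%E.
Proof.
have mI : measurable (`[(-1 : R), 1]%classic : set (measurableTypeR R)).
  exact: measurable_itv.
(* The disk lies in the square [-1, 1]^2, whose measure is finite. *)
apply: (@le_lt_trans _ _ (dA (`[(-1 : R), 1] `*` `[(-1 : R), 1]))).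
  apply: le_measure; rewrite ?inE.
  - exact: measurable_plane_disk.
  - exact: measurableX.
  - rewrite plane_diskE => -[x y] /= /ltW xy; rewrite !in_itv /= -!ler_norml.
    have le1 (t : R) : t ^+ 2 <= 1 -> `|t| <= 1.
      by rewrite -[t ^+ 2]real_normK ?num_real// expr_le1.
    by rewrite !le1// (le_trans _ xy)// ?lerDl ?lerDr sqr_ge0.
rewrite /dA/= /mscale /= product_measure1E//=.
rewrite lebesgue_measure_itv /= lte_fin gtrN// opprK -!EFinD -!EFinM.
exact: ltry.
Qed.

Definition disk_integrable f : Prop :=
  dA.-integrable plane_disk (EFin \o (fun p => complex.Re (f (of_plane p)))) /\
  dA.-integrable plane_disk (EFin \o (fun p => complex.Im (f (of_plane p)))).

Lemma eq_disk_integral f g : (forall x, disk x -> f x = g x) ->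
  disk_integral f = disk_integral g.
Proof.
move=> fg; congr Complex; apply: eq_Rintegral => p; rewrite inE => Dp;
  by rewrite fg.
Qed.


Lemma ReD (x y : C) : complex.Re (x + y) = complex.Re x + complex.Re y.
Proof. by case: x; case: y. Qed.

Lemma ImD (x y : C) : complex.Im (x + y) = complex.Im x + complex.Im y.
Proof. by case: x; case: y. Qed.

Lemma ReM (x y : C) : complex.Re (x * y) =
  complex.Re x * complex.Re y - complex.Im x * complex.Im y.
Proof. by case: x; case: y. Qed.

Lemma ImM (x y : C) : complex.Im (x * y) =
  complex.Re x * complex.Im y + complex.Im x * complex.Re y.
Proof. by case: x; case: y. Qed.

Lemma disk_integralD f g : disk_integrable f -> disk_integrable g ->
  disk_integral (fun x => f x + g x) = disk_integral f + disk_integral g.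
Proof.
move=> [f1 f2] [g1 g2]; have mD := @measurable_plane_disk R.
rewrite /disk_integral.
under eq_Rintegral do rewrite ReD.
under [in X in Complex _ X]eq_Rintegral do rewrite ImD.
by rewrite !RintegralD.
Qed.

Lemma disk_integralZ (c : C) f : disk_integrable f ->
  disk_integral (fun x => c * f x) = c * disk_integral f.
Proof.
move=> [f1 f2]; have mD := @measurable_plane_disk R.
have fZ r (g : plane -> R) : dA.-integrable plane_disk (EFin \o g) ->
  dA.-integrable plane_disk (EFin \o (fun x => r * g x)).
  by move=> /(integrableZl mD r).
rewrite /disk_integral.
under eq_Rintegral do rewrite ReM.
under [in X in Complex _ X]eq_Rintegral do rewrite ImM.
rewrite RintegralB ?RintegralD//; try exact: fZ.
by rewrite !RintegralZl//; case: c.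
Qed.

Lemma Linfty_norm_le1_ae (mu : C -> C) : (Linfty_norm mu <= 1)%E ->
  {ae dA, forall p, plane_disk p -> `|mu (of_plane p)| <= 1}.
Proof.
rewrite /Linfty_norm unlock => mu1.
have : {ae (@dA_disk R), forall p,
    (`|(complex.Re `|mu (of_plane p)|)%:E| <= 1)%E}.
  (* The norm with exponent +oo is an essential supremum only if the total mass is positive, and 0
     by convention otherwise; in the second case the whole plane serves as exceptional null set. *)
  case: ifPn mu1 => [_ /ess_supP//|/negP dA0 _].
  exists setT; split => //; apply/eqP; rewrite eq_le measure_ge0 andbT leNgt.
  exact/negP.
(* A null set for [dA_disk] becomes one for [dA] after intersection with the disk. *)
move=> [B [mB B0 sB]]; exists (B `&` plane_disk); split => //.
  exact: measurableI mB (@measurable_plane_disk R).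
move=> p /= pNle; split; last first.
  by apply: contrapT => Dp; apply: pNle => /Dp.
have norm_le1 (x : C) : (`|(complex.Re `|x|)%:E| <= 1)%E -> `|x| <= 1.
  rewrite lee_fin => x1; rewrite -(@RRe_real R `|x|) ?normr_real// (lecR _ 1).
  exact: le_trans (ler_norm _) x1.
by apply: sB => ple; apply: pNle => _; exact: norm_le1.
Qed.

(** [F] will be the real or the imaginary part: complex integrals are estimated componentwise. *)
Lemma ae_le1_bounded (mu g : C -> C) (M : R) (F : C -> R) :
  (forall x, (`|F x|)%:C%C <= `|x|) ->
  disk_measurable mu -> (Linfty_norm mu <= 1)%E ->
  (forall x, disk x -> `|g x| <= M%:C%C) ->
  {ae dA, forall p, plane_disk p ->
    (`|(F (mu (of_plane p) * g (of_plane p)))%:E| <= M%:E)%E}.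
Proof.
move=> F_le mmu /Linfty_norm_le1_ae mu1 gM.
apply: filterS mu1 => p mu1 Dp; rewrite lee_fin -lecR.
apply: le_trans (F_le _) _; rewrite normrM -[leRHS]mul1r.
by rewrite ler_pM ?mu1 ?gM.
Qed.

Lemma normc_ge_Im (x : C) : (`|complex.Im x|)%:C%C <= `|x|.
Proof.
rewrite normc_def lecR -sqrtr_sqr ler_sqrt ?addr_ge0 ?sqr_ge0//.
by rewrite lerDr sqr_ge0.
Qed.

Lemma ae_bounded_integral (f : plane -> R)
    (M : R) : 0 <= M -> measurable_fun plane_disk f ->
  {ae dA, forall p, plane_disk p -> (`|(f p)%:E| <= M%:E)%E} ->
  dA.-integrable plane_disk (EFin \o f) /\
  `|\int[dA]_(p in plane_disk) f p| <= M * fine (dA (@plane_disk R)).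
Proof.
move=> M0 mf fM; have mD := @measurable_plane_disk R.
have mEf : measurable_fun plane_disk (EFin \o f) by exact/measurable_EFinP.
have le_M := integral_le_bound M%:E mD mEf M0 fM.
have Vfin : dA (@plane_disk R) \is a fin_num.
  by rewrite ge0_fin_numE ?dA_disk_fin.
have fint : dA.-integrable plane_disk (EFin \o f).
  apply/integrableP; split => //; apply: le_lt_trans le_M _.
  by rewrite -(fineK Vfin) -EFinM ltry.
split => //; rewrite -lee_fin EFin_normr_Rintegral// EFinM fineK//.
exact: le_trans (le_abse_integral _ _ _) le_M.
Qed.

Lemma normc_le_ReIm (x : C) :
  `|x| <= (`|complex.Re x| + `|complex.Im x|)%:C%C.
Proof.
rewrite normc_def lecR -(@ler_pXn2r _ 2) ?nnegrE ?sqrtr_ge0 ?addr_ge0//.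
rewrite sqr_sqrtr ?addr_ge0 ?sqr_ge0// sqrrD !real_normK ?num_real//.
by rewrite addrAC lerDl mulrn_wge0// mulr_ge0.
Qed.

(** The real and imaginary parts of the integral are each at most [M] times the area, since |mu| <=
    1 almost everywhere; adding them gives the factor 2. *)
Lemma bounded_disk_integral (mu g : C -> C) (M : C) :
  disk_measurable mu -> (Linfty_norm mu <= 1)%E ->
  disk_measurable g -> (forall x, disk x -> `|g x| <= M) -> 0 <= M ->
  disk_integrable (fun x => mu x * g x) /\
  `|disk_integral (fun x => mu x * g x)|
    <= M * (fine (dA (@plane_disk R)) *+ 2)%:C%C.
Proof.
move=> mmu mu1 mg gM M0.
(* Norms on [C] are complex numbers; a nonnegative one is an embedded real, as the real integral
   bounds require. *)
have [r Mr r0] : exists2 r : R, M = r%:C%C & 0 <= r.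
  exists (complex.Re M); last by move: M0; rewrite lecE => /andP[].
  by rewrite RRe_real// ger0_real.
rewrite {}Mr {M M0} in gM *.
have [mRe mIm] := disk_measurableM mmu mg.
have [iRe leRe] := ae_bounded_integral r0 mRe
  (ae_le1_bounded (@normc_ge_Re R) mmu mu1 gM).
have [iIm leIm] := ae_bounded_integral r0 mIm
  (ae_le1_bounded normc_ge_Im mmu mu1 gM).
split=> //; apply: le_trans (normc_le_ReIm _) _.
by rewrite -rmorphM lecR /= mulrnAr mulr2n lerD.
Qed.

End DiskIntegral.

(** * Differentials from expansions with quadratic remainder *)

Section QuadraticExpansion.
Context {C : numFieldType}.
Set Implicit Arguments.
Unset Strict Implicit.

(** The differential on C^2 with partial derivatives [a] and [b], named so that a linear structure
    can be attached to it. *)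
Definition dual_pair (a b : C) (h : C * C) : C := h.1 * a + h.2 * b.

Lemma dual_pair_is_linear a b : linear (dual_pair a b).
Proof.
by move=> c [x y] [u v]; rewrite /dual_pair /= /GRing.scale /=; ring.
Qed.

HB.instance Definition _ a b :=
  GRing.isLinear.Build C (C * C)%type C *:%R (dual_pair a b)
    (dual_pair_is_linear a b).

Lemma dual_pair_continuous a b : continuous (dual_pair a b).
Proof.
move=> h; apply: cvgD; apply: cvgM; try exact: cvg_cst.
  exact: cvg_fst.
exact: cvg_snd.
Qed.

(** A remainder O(|h|^2) is o(|h|), and a continuous linear map with an o(|h|) remainder is the
    differential. *)
Lemma is_diff_quadratic (f : C * C -> C) (p : C * C) (a b M : C) : 0 < M ->
  (\forall h \near (0 : (C * C)%type),
    `|f (h + p) - f p - dual_pair a b h| <= M * `|h| ^+ 2) ->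
  is_diff p f (dual_pair a b).
Proof.
move=> M0 fM.
have E : f \o shift p = cst (f p) + dual_pair a b +o_ (0 : (C * C)%type) id.
  apply/eqaddoP => _/posnumP[e]; near=> h.
  have -> : (f \o shift p - (cst (f p) + dual_pair a b)) h =
    f (h + p) - f p - dual_pair a b h by rewrite !fctE /= opprD addrA.
  apply: (@le_trans _ _ (M * `|h| ^+ 2)); first by near: h.
  (* M |h|^2 <= e |h| as soon as |h| <= e / M. *)
  rewrite expr2 mulrA ler_wpM2r// -ler_pdivlMl//.
  near: h; apply: (nbhs0_le (V := (C * C)%type)).
  by rewrite mulr_gt0 ?invr_gt0.
have D := diff_unique (dual_pair_continuous (a := a) (b := b)) E.
split => //; apply/diff_locallyP; rewrite D; split => //.
exact: dual_pair_continuous.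
Unshelve. all: by end_near. Qed.

(** Chain rule along the affine inclusion of the first coordinate line through (z, w). *)
Lemma derive1_fst (f : C * C -> C) (z w a b : C) :
  is_diff (z, w) f (dual_pair a b) -> derive1 (fun z' => f (z', w)) z = a.
Proof.
move=> df.
have g : is_diff z (fun z' : C => (z', w)) (fun h => (h, 0)).
  exact: (is_diff_pair (is_diff_id z) (is_diff_cst w z)).
have := is_diff_comp g df => fg.
rewrite derive1E'; last exact: ex_diff.
by rewrite diff_val /= /dual_pair /= mul1r mul0r addr0.
Qed.

Lemma derive1_snd (f : C * C -> C) (z w a b : C) :
  is_diff (z, w) f (dual_pair a b) -> derive1 (fun w' => f (z, w')) w = b.
Proof.
move=> df.
have g : is_diff w (fun w' : C => (z, w')) (fun h => (0, h)).
  exact: (is_diff_pair (is_diff_cst z w) (is_diff_id w)).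
have := is_diff_comp g df => fg.
rewrite derive1E'; last exact: ex_diff.
by rewrite diff_val /= /dual_pair /= mul1r mul0r add0r.
Qed.

End QuadraticExpansion.

(** * Second-order expansions uniform in the integration variable *)

Section KernelExpansion.
Context {R : realType}.
Local Notation C := (Cplx R).
Implicit Types (k : C -> C -> C -> C) (A B : C -> C).
Set Implicit Arguments.
Unset Strict Implicit.

(** Product rule with explicit remainder: [a1], [a2] are the values, [l1], [l2] the linear terms,
    and [d] is the size of the increment. The constant 6 is 1 + 3 + 2, one summand for each term of
    the remainder split below. *)
Lemma norm_expansionM (N d a1 a2 l1 l2 x y : C) : 1 <= N -> 0 <= d ->
  N * d <= 1 -> `|a1| <= N -> `|a2| <= N -> `|l1| <= N * d -> `|l2| <= N * d ->
  `|x - a1 - l1| <= N * d ^+ 2 -> `|y - a2 - l2| <= N * d ^+ 2 ->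
  `|x * y - a1 * a2 - (l1 * a2 + a1 * l2)| <= (N ^+ 2 *+ 6) * d ^+ 2.
Proof.
move=> N1 d0 Nd1 a1N a2N l1N l2N r1N r2N.
have N0 : 0 <= N by exact: le_trans N1.
have d1 : d <= 1 by apply: le_trans Nd1; rewrite ler_peMl.
have NdN : N * d <= N by rewrite ler_piMr.
have Nd2N : N * d ^+ 2 <= N by rewrite ler_piMr// expr_le1.
(* [y] is the sum of its remainder, [l2] and [a2], each of norm at most [N] because d <= 1. *)
have yN : `|y| <= N *+ 3.
  rewrite -(subrK a2 y) -(subrK l2 (y - a2)) [N *+ 3]mulrSr mulr2n.
  apply: le_trans (ler_normD _ _) _; apply: lerD => //.
  apply: le_trans (ler_normD _ _) _; apply: lerD.
    exact: le_trans Nd2N.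
  exact: le_trans NdN.
have -> : x * y - a1 * a2 - (l1 * a2 + a1 * l2) =
  l1 * l2 + (x - a1 - l1) * y + (a1 + l1) * (y - a2 - l2) by ring.
have -> : N ^+ 2 *+ 6 * d ^+ 2 =
  (N * d) * (N * d) + (N * d ^+ 2) * (N *+ 3) + (N *+ 2) * (N * d ^+ 2).
  by ring.
apply: le_trans (ler_normD _ _) _; apply: lerD; last first.
  rewrite normrM ler_pM// mulr2n; apply: le_trans (ler_normD _ _) _.
  by apply: lerD => //; exact: le_trans NdN.
apply: le_trans (ler_normD _ _) _; apply: lerD; rewrite normrM ler_pM//.
Qed.

(* A B : partial derivatives of k at (z, w).  Using the one constant M both for
   the remainder and for the radius 1/M of validity makes the bound monotone
   in M, so that two expansions can be brought to a common constant. *)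
Definition expansion_bound k (z w : C) A B (M : C) : Prop :=
  (forall x, disk x -> [/\ `|k z w x| <= M, `|A x| <= M & `|B x| <= M]) /\
  (forall h1 h2, M * (`|h1| + `|h2|) <= 1 -> forall x, disk x ->
    `|k (z + h1) (w + h2) x - k z w x - (h1 * A x + h2 * B x)|
      <= M * (`|h1| + `|h2|) ^+ 2).

(** The hypothesis for differentiating under the integral sign at (z, w). *)
Definition uniform_expansion k (z w : C) A B : Prop :=
  [/\ forall z' w', disk_measurable (k z' w'), disk_measurable A,
      disk_measurable B & exists2 M, 1 <= M & expansion_bound k z w A B M].

Lemma le_expansion_bound k z w A B M N : 0 <= M -> M <= N ->
  expansion_bound k z w A B M -> expansion_bound k z w A B N.
Proof.
move=> M0 MN [bM eM]; split=> [x /bM[? ? ?]|h1 h2 Nh x Dx].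
  by split; apply: le_trans MN.
apply: (@le_trans _ _ (M * (`|h1| + `|h2|) ^+ 2)).
  by apply: eM => //; apply: le_trans Nh; rewrite ler_wpM2r// addr_ge0.
by rewrite ler_wpM2r// exprn_ge0// addr_ge0.
Qed.

Lemma uniform_expansionM k1 k2 z w A1 A2 B1 B2 :
  uniform_expansion k1 z w A1 B1 -> uniform_expansion k2 z w A2 B2 ->
  uniform_expansion (fun z' w' x => k1 z' w' x * k2 z' w' x) z w
    (fun x => A1 x * k2 z w x + k1 z w x * A2 x)
    (fun x => B1 x * k2 z w x + k1 z w x * B2 x).
Proof.
move=> [mk1 mA1 mB1 [M1 M11 E1]] [mk2 mA2 mB2 [M2 M21 E2]].
have M10 : 0 <= M1 by exact: le_trans M11.
have M20 : 0 <= M2 by exact: le_trans M21.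
(* A common constant for both factors, by monotonicity. *)
pose N := M1 + M2.
have N1 : 1 <= N by rewrite (le_trans M11)// lerDl.
have N0 : 0 <= N by exact: le_trans N1.
have {E1}[b1 e1] : expansion_bound k1 z w A1 B1 N.
  by apply: le_expansion_bound E1; rewrite // lerDl.
have {E2}[b2 e2] : expansion_bound k2 z w A2 B2 N.
  by apply: le_expansion_bound E2; rewrite // lerDr.
have NN6 : N <= N ^+ 2 *+ 6.
  rewrite (@le_trans _ _ (N ^+ 2))// ?expr2 ?ler_peMr//.
  by rewrite -[leLHS]mulr1n ler_wpMn2l// mulr_ge0.
split; first by move=> z' w'; exact: disk_measurableM.
- by apply: disk_measurableD; exact: disk_measurableM.
- by apply: disk_measurableD; exact: disk_measurableM.
(* The remainder constant of [norm_expansionM]. It also exceeds N, which keeps the increment within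
   the radius of both factors, and 2 N^2, which bounds the Leibniz sums. *)
exists (N ^+ 2 *+ 6); first exact: le_trans NN6.
have prodN a b : `|a| <= N -> `|b| <= N -> `|a * b| <= N ^+ 2.
  by move=> aN bN; rewrite normrM expr2 ler_pM.
have N2_6 : N ^+ 2 <= N ^+ 2 *+ 6.
  by rewrite -[leLHS]mulr1n ler_wpMn2l// exprn_ge0.
have N2_6' a b : `|a| <= N ^+ 2 -> `|b| <= N ^+ 2 -> `|a + b| <= N ^+ 2 *+ 6.
  move=> aN bN; apply: le_trans (ler_normD _ _) _.
  apply: le_trans (lerD aN bN) _.
  by rewrite -mulr2n ler_wpMn2l// exprn_ge0.
split=> [x Dx|h1 h2 Nh x Dx].
  have [? ? ?] := b1 x Dx; have [? ? ?] := b2 x Dx; split.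
  - by apply: le_trans N2_6; exact: prodN.
  - by apply: N2_6'; exact: prodN.
  - by apply: N2_6'; exact: prodN.
have [k1N A1N B1N] := b1 x Dx; have [k2N A2N B2N] := b2 x Dx.
have d0 : 0 <= `|h1| + `|h2| by rewrite addr_ge0.
have {}Nh : N * (`|h1| + `|h2|) <= 1.
  by apply: le_trans Nh; rewrite ler_wpM2r.
have lin a b : `|a| <= N -> `|b| <= N ->
    `|h1 * a + h2 * b| <= N * (`|h1| + `|h2|).
  move=> aN bN; rewrite mulrDr; apply: le_trans (ler_normD _ _) _.
  by rewrite !normrM ![N * _]mulrC; apply: lerD; rewrite ler_wpM2l.
have := norm_expansionM N1 d0 Nh k1N k2N (lin _ _ A1N B1N) (lin _ _ A2N B2N)
  (e1 _ _ Nh x Dx) (e2 _ _ Nh x Dx).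
by congr (`|_ - _| <= _); ring.
Qed.

(** Transfers expansions of kernels in the first variable to the second one. *)
Lemma uniform_expansionC k z w A B : uniform_expansion k z w A B ->
  uniform_expansion (fun z' w' => k w' z') w z B A.
Proof.
move=> [mk mA mB [M M1 [bM eM]]]; split => //; exists M => //.
split=> [x /bM[]//|h1 h2 Mh x Dx].
by rewrite [`|h1| + _]addrC [h1 * _ + _]addrC eM// addrC.
Qed.

(* The conjugate of szego z: holomorphic in z, antiholomorphic in x. *)
Definition cauchy_kernel (z x : C) : C := (1 - z * x^*%R)^-1.

Lemma measurable_cauchy z : disk_measurable (cauchy_kernel z).
Proof.
apply/disk_measurableV/disk_measurableD; first exact: disk_measurable_cst.
rewrite (_ : (fun x => - (z * x^*)%R) = (fun x => - z * x^*%R)); last first.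
  by apply/funext => x; rewrite mulNr.
by apply: disk_measurableM; [exact: disk_measurable_cst|
  exact: disk_measurable_conj].
Qed.

Lemma norm_conj_lt1 (x : C) : disk x -> `|x^*%R| < 1.
Proof. by rewrite norm_conjC. Qed.

(** Reverse triangle inequality with |z conj x| <= |z|: the denominator stays away from 0 uniformly
    in [x]. *)
Lemma cauchy_den_ge (z x : C) : disk x -> 1 - `|z| <= `|1 - z * x^*%R|.
Proof.
move=> Dx; rewrite (le_trans _ (lerB_dist _ _))// normr1 lerB// normrM.
by rewrite ler_piMr// ltW// norm_conj_lt1.
Qed.

Lemma cauchy_den_neq0 (z x : C) : disk z -> disk x -> 1 - z * x^*%R != 0.
Proof.
move=> Dz Dx; rewrite -normr_gt0 (lt_le_trans _ (cauchy_den_ge z Dx))//.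
by rewrite subr_gt0.
Qed.

Lemma norm_cauchy_le (z x : C) : disk z -> disk x ->
  `|cauchy_kernel z x| <= (1 - `|z|)^-1.
Proof.
move=> Dz Dx; rewrite normfV lef_pV2 ?posrE ?cauchy_den_ge// ?subr_gt0//.
by rewrite normr_gt0 cauchy_den_neq0.
Qed.

(** A shift by at most half the distance from [z] to the unit circle leaves at least half of that
    distance. *)
Lemma norm_cauchy_shift_le (z h : C) : disk z ->
  2 * `|h| <= 1 - `|z| ->
  disk (z + h) /\
  forall x, disk x -> `|cauchy_kernel (z + h) x| <= 2 / (1 - `|z|).
Proof.
move=> Dz hz; have z0 : 0 < 1 - `|z| by rewrite subr_gt0.
have zh : (1 - `|z|) / 2 <= 1 - `|z + h|.
  have h2 : `|h| <= (1 - `|z|) / 2 by rewrite ler_pdivlMr// mulrC.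
  have -> : (1 - `|z|) / 2 = 1 - (`|z| + (1 - `|z|) / 2) by field.
  by rewrite lerB// (le_trans (ler_normD _ _))// lerD.
have zh0 : 0 < 1 - `|z + h| by rewrite (lt_le_trans _ zh)// divr_gt0.
have Dzh : disk (z + h) by rewrite /disk /= -subr_gt0.
split=> // x Dx; apply: le_trans (norm_cauchy_le Dzh Dx) _.
by rewrite -[leRHS]invrK lef_pV2 ?posrE ?invf_div// divr_gt0.
Qed.

(** Collects under one constant the values, derivatives and remainder factors that occur in the two
    expansions that follow. *)
Lemma cauchy_bounds z : disk z -> exists2 M : C, 1 <= M &
  (forall x, disk x ->
    [/\ `|cauchy_kernel z x| <= M, `|z * cauchy_kernel z x| <= M,
        `|cauchy_kernel z x ^+ 2| <= M &
        `|x^*%R * cauchy_kernel z x ^+ 2| <= M]) /\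
  (forall h, M * `|h| <= 1 -> disk (z + h) /\ forall x, disk x ->
    `|cauchy_kernel z x ^+ 2 * cauchy_kernel (z + h) x| <= M).
Proof.
move=> Dz; have z0 : 0 < 1 - `|z| by rewrite subr_gt0.
set c := (1 - `|z|)^-1.
have c1 : 1 <= c by rewrite invf_ge1// gerBl.
have c0 : 0 <= c by exact: le_trans c1.
have cc2 : c <= c ^+ 2 by rewrite expr2 ler_peMr.
have c2c3 : c ^+ 2 <= c ^+ 3 by rewrite [c ^+ 3]exprS ler_peMl ?exprn_ge0.
have c3M : c ^+ 3 <= c ^+ 3 *+ 2 by rewrite mulr2n lerDl exprn_ge0.
have c2M := le_trans c2c3 c3M; have cM := le_trans cc2 c2M.
have u2 x : disk x -> `|cauchy_kernel z x ^+ 2| <= c ^+ 2.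
  by move=> Dx; rewrite normrX lerXn2r ?nnegrE ?norm_cauchy_le.
(* With c = 1 / (1 - |z|) >= 1, the factor u_z^2 costs c^2 and the shifted kernel costs 2c. Moreover
   2c <= 2c^3, so the radius 1/M allows the shift. *)
exists (c ^+ 3 *+ 2); first exact: le_trans cM.
split=> [x Dx|h Mh].
  have uc : `|cauchy_kernel z x| <= c by exact: norm_cauchy_le.
  split.
  - exact: le_trans cM.
  - by rewrite normrM (le_trans _ (le_trans uc cM))// ler_piMl// ltW.
  - exact: le_trans (u2 x Dx) c2M.
  - rewrite normrM (le_trans _ (le_trans (u2 x Dx) c2M))// ler_piMl//.
    by rewrite ltW// norm_conj_lt1.
have zh : 2 * `|h| <= 1 - `|z|.
  rewrite -[leRHS]mulr1 -ler_pdivrMl// -/c (le_trans _ Mh)// mulrA ler_wpM2r//.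
  by rewrite mulr_natr ler_wMn2r// (le_trans cc2).
have [Dzh uh] := norm_cauchy_shift_le Dz zh; split=> // x Dx.
rewrite normrM (le_trans (ler_pM _ _ (u2 x Dx) (uh x Dx)))//.
by rewrite -/c mulrCA -exprSr mulr_natl.
Qed.

Lemma uniform_expansion_cauchy z w : disk z ->
  uniform_expansion (fun z' _ => cauchy_kernel z') z w
    (fun x => x^*%R * cauchy_kernel z x ^+ 2) (fun=> 0).
Proof.
move=> Dz; have mu2 : disk_measurable (fun x => cauchy_kernel z x ^+ 2).
  exact: disk_measurableM (measurable_cauchy z) (measurable_cauchy z).
split; first by move=> z' _; exact: measurable_cauchy.
- exact: disk_measurableM disk_measurable_conj mu2.
- exact: disk_measurable_cst.
have [M M1 [bM eM]] := cauchy_bounds Dz; have M0 : 0 <= M by exact: le_trans M1.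
exists M => //; split=> [x /bM[]|h1 h2 Mh x Dx].
  by rewrite normr0.
have hd : `|h1| <= `|h1| + `|h2| by rewrite lerDl.
have [Dzh /(_ x Dx) ub] : disk (z + h1) /\ forall x, disk x ->
    `|cauchy_kernel z x ^+ 2 * cauchy_kernel (z + h1) x| <= M.
  by apply: eM; rewrite (le_trans _ Mh)// ler_wpM2l.
(* The remainder has a closed form: u_z' = conj x u_z^2, and the rest is exactly quadratic in
   [h1]. *)
have -> : cauchy_kernel (z + h1) x - cauchy_kernel z x
    - (h1 * (x^*%R * cauchy_kernel z x ^+ 2) + h2 * 0) =
    (cauchy_kernel z x ^+ 2 * cauchy_kernel (z + h1) x) * (h1 * x^*%R) ^+ 2.
  rewrite /cauchy_kernel; field.
  by rewrite !cauchy_den_neq0.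
rewrite normrM ler_pM// normrX lerXn2r ?nnegrE ?addr_ge0// normrM.
by rewrite (le_trans _ hd)// ler_piMr// ltW// norm_conj_lt1.
Qed.

Lemma uniform_expansion_id_cauchy z w : disk z ->
  uniform_expansion (fun z' _ x => z' * cauchy_kernel z' x) z w
    (fun x => cauchy_kernel z x ^+ 2) (fun=> 0).
Proof.
move=> Dz; have mu := @measurable_cauchy; split.
- by move=> z' _; exact: disk_measurableM (disk_measurable_cst _) (mu _).
- exact: disk_measurableM (mu z) (mu z).
- exact: disk_measurable_cst.
have [M M1 [bM eM]] := cauchy_bounds Dz; have M0 : 0 <= M by exact: le_trans M1.
exists M => //; split=> [x /bM[]|h1 h2 Mh x Dx].
  by rewrite normr0.
have hd : `|h1| <= `|h1| + `|h2| by rewrite lerDl.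
have [Dzh /(_ x Dx) ub] : disk (z + h1) /\ forall x, disk x ->
    `|cauchy_kernel z x ^+ 2 * cauchy_kernel (z + h1) x| <= M.
  by apply: eM; rewrite (le_trans _ Mh)// ler_wpM2l.
(* Again an exact remainder, now with (z u_z)' = u_z^2. *)
have -> : (z + h1) * cauchy_kernel (z + h1) x - z * cauchy_kernel z x
    - (h1 * cauchy_kernel z x ^+ 2 + h2 * 0) =
    (cauchy_kernel z x ^+ 2 * cauchy_kernel (z + h1) x) * (h1 ^+ 2 * x^*%R).
  rewrite /cauchy_kernel; field.
  by rewrite !cauchy_den_neq0.
rewrite normrM ler_pM// normrM normrX.
rewrite (le_trans (ler_piMr _ (ltW (norm_conj_lt1 Dx))))// ?exprn_ge0//.
by rewrite lerXn2r ?nnegrE ?addr_ge0.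
Qed.

End KernelExpansion.

(** * Differentiation under the integral sign *)

Section IntegralTransform.
Context {R : realType}.
Local Notation C := (Cplx R).
Context (mu : C -> C).
Context (mmu : disk_measurable mu) (mu_le1 : (Linfty_norm mu <= 1)%E).
Implicit Types (k : C -> C -> C -> C) (f g A B : C -> C).
Set Implicit Arguments.
Unset Strict Implicit.

Definition mu_integral g : C := disk_integral (fun x => mu x * g x).

(** A class closed under sums and products on which integration against [mu] is linear. *)
Definition disk_bounded g : Prop :=
  disk_measurable g /\ exists2 M : C, 0 <= M & forall x, disk x -> `|g x| <= M.

Lemma disk_bounded_integrable g : disk_bounded g ->
  disk_integrable (fun x => mu x * g x).
Proof.
by move=> [mg [M M0 gM]]; have [] := bounded_disk_integral mmu mu_le1 mg gM M0.
Qed.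

Lemma disk_boundedD f g : disk_bounded f -> disk_bounded g ->
  disk_bounded (fun x => f x + g x).
Proof.
move=> [mf [M M0 fM]] [mg [N N0 gN]]; split; first exact: disk_measurableD.
exists (M + N); first exact: addr_ge0.
by move=> x Dx; apply: le_trans (ler_normD _ _) _; rewrite lerD ?fM ?gN.
Qed.

Lemma disk_boundedM f g : disk_bounded f -> disk_bounded g ->
  disk_bounded (fun x => f x * g x).
Proof.
move=> [mf [M M0 fM]] [mg [N N0 gN]]; split; first exact: disk_measurableM.
exists (M * N); first exact: mulr_ge0.
by move=> x Dx; rewrite normrM ler_pM ?fM ?gN.
Qed.

Lemma disk_bounded_cst (c : C) : disk_bounded (fun=> c).
Proof. by split; [exact: disk_measurable_cst|exists `|c|]. Qed.

Lemma disk_bounded_cauchy (z : C) : disk z -> disk_bounded (cauchy_kernel z).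
Proof.
move=> Dz; split; first exact: measurable_cauchy.
exists (1 - `|z|)^-1; first by rewrite invr_ge0 subr_ge0 ltW.
by move=> x; exact: norm_cauchy_le.
Qed.

Lemma eq_mu_integral f g : (forall x, disk x -> f x = g x) ->
  mu_integral f = mu_integral g.
Proof. by move=> fg; apply: eq_disk_integral => x /fg ->. Qed.

Lemma mu_integralD f g : disk_bounded f -> disk_bounded g ->
  mu_integral (fun x => f x + g x) = mu_integral f + mu_integral g.
Proof.
move=> /disk_bounded_integrable bf /disk_bounded_integrable bg.
rewrite -disk_integralD//; congr disk_integral.
by apply/funext => x; rewrite mulrDr.
Qed.

Lemma mu_integralZ (c : C) f : disk_bounded f ->
  mu_integral (fun x => c * f x) = c * mu_integral f.
Proof.
move=> /disk_bounded_integrable bf.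
rewrite -disk_integralZ//; congr disk_integral.
by apply/funext => x; rewrite mulrCA.
Qed.

Lemma uniform_expansion_bounded k z w A B : uniform_expansion k z w A B ->
  [/\ disk_bounded (k z w), disk_bounded A & disk_bounded B].
Proof.
move=> [mk mA mB [M M1 [bM _]]]; have M0 : 0 <= M by exact: le_trans M1.
by split; split => //; exists M => // x /bM[].
Qed.

Lemma norm_fst_le (h : C * C) : `|h.1| <= `|h|.
Proof.
by rewrite prod_normE /= comparable_le_max ?real_comparable// lexx.
Qed.

Lemma norm_snd_le (h : C * C) : `|h.2| <= `|h|.
Proof.
by rewrite prod_normE /= comparable_le_max ?real_comparable// lexx orbT.
Qed.

(** The remainder of the integral is the integral of the remainder, hence still quadratic. [f] has
    to agree with the integral only on the bidisk, an open set. *)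
Lemma is_diff_mu_integral (f : C * C -> C) k z w A B :
  uniform_expansion k z w A B ->
  (forall z' w', disk z' -> disk w' -> disk_bounded (k z' w')) ->
  (forall z' w', disk z' -> disk w' -> f (z', w') = mu_integral (k z' w')) ->
  disk z -> disk w ->
  is_diff (z, w) f (dual_pair (mu_integral A) (mu_integral B)).
Proof.
move=> Ek bk fk Dz Dw; have [bkz bA bB] := uniform_expansion_bounded Ek.
have [_ mA mB [M M1 [_ eM]]] := Ek.
have M0 : 0 < M by exact: lt_le_trans M1.
set K := (fine (dA (@plane_disk R)) *+ 2)%:C%C.
have K0 : 0 <= K by rewrite lecR mulrn_wge0// fine_ge0.
(* 4 comes from |h.1| + |h.2| <= 2 |h| in the sup norm and [K] from the mass of the disk; [K + 1]
   makes the constant positive. *)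
apply: (@is_diff_quadratic _ _ _ _ _ (M * 4 * (K + 1))).
  by rewrite !mulr_gt0// ltr_wpDl.
near=> h.
have h1 := norm_fst_le h; have h2 := norm_snd_le h.
have hd : `|h.1| + `|h.2| <= 2 * `|h| by rewrite mulr_natl mulr2n lerD.
have Mh : M * (`|h.1| + `|h.2|) <= 1.
  rewrite -ler_pdivlMl// mulr1 (le_trans hd)// -ler_pdivlMl//.
  by near: h; apply: (nbhs0_le (V := (C * C)%type)); rewrite mulr_gt0 ?invr_gt0.
have Dzh : disk (z + h.1).
  rewrite /disk /= (le_lt_trans (ler_normD _ _))// -ltrBrDl (le_lt_trans h1)//.
  by near: h; apply: (nbhs0_lt (V := (C * C)%type)); rewrite subr_gt0.
have Dwh : disk (w + h.2).
  rewrite /disk /= (le_lt_trans (ler_normD _ _))// -ltrBrDl (le_lt_trans h2)//.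
  by near: h; apply: (nbhs0_lt (V := (C * C)%type)); rewrite subr_gt0.
have bh := bk _ _ Dzh Dwh.
have bZ c g : disk_bounded g -> disk_bounded (fun x => c * g x).
  exact: disk_boundedM (disk_bounded_cst _).
(* The pointwise remainder, with differences written as sums of scalar multiples so that linearity
   of [mu_integral] applies. *)
pose r x := k (z + h.1) (w + h.2) x + (-1 * k z w x
  + (- h.1 * A x + - h.2 * B x)).
have bk1 := bZ (-1) _ bkz; have bA1 := bZ (- h.1) _ bA.
have bB1 := bZ (- h.2) _ bB; have bAB := disk_boundedD bA1 bB1.
have bkAB := disk_boundedD bk1 bAB; have br : disk_bounded r.
  exact: disk_boundedD bh bkAB.
have -> : f (h + (z, w)) - f (z, w) -
    dual_pair (mu_integral A) (mu_integral B) h = mu_integral r.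
  have -> : h + (z, w) = (z + h.1, w + h.2) :> C * C.
    by case: (h) => x y; rewrite /= [z + _]addrC [w + _]addrC.
  rewrite !fk// /r /dual_pair (mu_integralD bh bkAB) (mu_integralD bk1 bAB).
  rewrite (mu_integralD bA1 bB1) !mu_integralZ//.
  by ring.
have rM x : disk x -> `|r x| <= M * (`|h.1| + `|h.2|) ^+ 2.
  move=> Dx; apply: le_trans (eM _ _ Mh x Dx).
  suff -> : r x = k (z + h.1) (w + h.2) x - k z w x - (h.1 * A x + h.2 * B x).
    exact: lexx.
  by rewrite /r; ring.
have [_ leI] := bounded_disk_integral mmu mu_le1 br.1 rM
  (mulr_ge0 (ltW M0) (exprn_ge0 _ (addr_ge0 (normr_ge0 _) (normr_ge0 _)))).
apply: le_trans leI _; rewrite -/K.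
have d2 : (`|h.1| + `|h.2|) ^+ 2 <= 4 * `|h| ^+ 2.
  have -> : 4 * `|h| ^+ 2 = (2 * `|h|) ^+ 2 by ring.
  by rewrite lerXn2r ?nnegrE ?mulr_ge0 ?addr_ge0.
have -> : M * 4 * (K + 1) * `|h| ^+ 2 = M * (4 * `|h| ^+ 2) * (K + 1) by ring.
rewrite ler_pM ?lerDl// ?mulr_ge0 ?exprn_ge0 ?addr_ge0 ?(ltW M0)//.
by rewrite ler_wpM2l// ltW.
Unshelve. all: by end_near. Qed.

End IntegralTransform.

(** * The symbol of a multiplication operator and its wave equation *)

Section MultiplicationSymbol.
Context {R : realType}.
Set Implicit Arguments.
Unset Strict Implicit.
Local Notation C := (Cplx R).
Context (mu : C -> C).
Context (mmu : disk_measurable mu) (mu_le1 : (Linfty_norm mu <= 1)%E).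
Local Notation Q := (dirichlet_symbol (mulop mu)).
Local Notation I := (mu_integral mu).
Local Notation u := cauchy_kernel.

Lemma conj_szego (z x : C) : (szego z x)^*%R = u z x.
Proof.
by rewrite /szego fmorphV rmorphB rmorph1 rmorphM /= [X in X * _](conjcK z).
Qed.

Definition symbol_kernel (z w x : C) : C := (z * u z x) * (w * u w x).

(** The w-derivative of [symbol_kernel]; the square is a product so that [uniform_expansionM]
    matches it. *)
Definition symbol_kernel_dw (z w x : C) : C := (z * u z x) * (u w x * u w x).

Lemma disk_bounded_id_cauchy (z : C) : disk z ->
  disk_bounded (fun x => z * u z x).
Proof.
move=> Dz; exact: disk_boundedM (disk_bounded_cst z) (disk_bounded_cauchy Dz).
Qed.

Lemma disk_bounded_symbol_kernel (z w : C) : disk z -> disk w ->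
  disk_bounded (symbol_kernel z w).
Proof.
move=> Dz Dw.
exact: disk_boundedM (disk_bounded_id_cauchy Dz) (disk_bounded_id_cauchy Dw).
Qed.

Lemma disk_bounded_symbol_kernel_dw (z w : C) : disk z -> disk w ->
  disk_bounded (symbol_kernel_dw z w).
Proof.
move=> Dz Dw; have bu := disk_bounded_cauchy Dw.
exact: disk_boundedM (disk_bounded_id_cauchy Dz) (disk_boundedM bu bu).
Qed.

Lemma symbolE (z w : C) : disk z -> disk w -> Q z w = I (symbol_kernel z w).
Proof.
move=> Dz Dw; rewrite /dirichlet_symbol /disk_inner.
have buu := disk_boundedM (disk_bounded_cauchy Dz) (disk_bounded_cauchy Dw).
transitivity (z * w * I (fun x => u z x * u w x)).
  congr (_ * _); apply: eq_disk_integral => x Dx.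
  by rewrite /mulop !conj_szego -mulrA [u w x * _]mulrC.
rewrite -mu_integralZ//; apply: eq_mu_integral => x Dx.
by rewrite /symbol_kernel mulrACA.
Qed.

Lemma is_diff_symbol (z w : C) : disk z -> disk w ->
  is_diff (z, w) (fun q : C * C => Q q.1 q.2)
    (dual_pair (I (fun x => u z x ^+ 2 * (w * u w x)))
               (I (symbol_kernel_dw z w))).
Proof.
move=> Dz Dw.
have E := uniform_expansionM (uniform_expansion_id_cauchy w Dz)
  (uniform_expansionC (uniform_expansion_id_cauchy z Dw)).
have := is_diff_mu_integral mmu mu_le1
  (f := fun q : C * C => Q q.1 q.2) E disk_bounded_symbol_kernel
  symbolE Dz Dw.
(* Each factor depends on one variable only, so a single Leibniz term survives in each partial
   derivative. *)
congr (is_diff _ _ (dual_pair _ _)); apply: eq_mu_integral => x Dx.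
  by rewrite mulr0 addr0.
by rewrite mul0r add0r expr2.
Qed.

Lemma symbol_dzE (z w : C) : disk z -> disk w ->
  d_z Q z w = I (fun x => u z x ^+ 2 * (w * u w x)).
Proof. by move=> Dz Dw; exact: derive1_fst (is_diff_symbol Dz Dw). Qed.

Lemma symbol_dwE (z w : C) : disk z -> disk w ->
  d_w Q z w = I (symbol_kernel_dw z w).
Proof. by move=> Dz Dw; exact: derive1_snd (is_diff_symbol Dz Dw). Qed.

(** Only the z-partial, the mixed derivative, enters the equation; the w-partial stays
    existential. *)
Lemma is_diff_symbol_dw (z w : C) : disk z -> disk w -> exists b : C,
  is_diff (z, w) (fun q : C * C => d_w Q q.1 q.2)
    (dual_pair (I (fun x => u z x ^+ 2 * u w x ^+ 2)) b).
Proof.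
move=> Dz Dw; have Ew := uniform_expansionC (uniform_expansion_cauchy z Dw).
have E := uniform_expansionM (uniform_expansion_id_cauchy w Dz)
  (uniform_expansionM Ew Ew).
have := is_diff_mu_integral mmu mu_le1
  (f := fun q : C * C => d_w Q q.1 q.2) E disk_bounded_symbol_kernel_dw
  symbol_dwE Dz Dw.
move=> df; eexists; move: df; congr (is_diff _ _ (dual_pair _ _)).
by apply: eq_mu_integral => x Dx; rewrite mul0r !mulr0 addr0 mulr0 addr0 -expr2.
Qed.

Lemma symbol_dz_dwE (z w : C) : disk z -> disk w ->
  d_z (d_w Q) z w = I (fun x => u z x ^+ 2 * u w x ^+ 2).
Proof. by move=> Dz Dw; have [b /derive1_fst] := is_diff_symbol_dw Dz Dw. Qed.

Lemma symbol_wave_equation (z w : C) : disk z -> disk w ->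
  z * w * (z - w) * d_z (d_w Q) z w =
  z ^+ 2 * d_z Q z w - w ^+ 2 * d_w Q z w.
Proof.
move=> Dz Dw; rewrite symbol_dz_dwE// symbol_dzE// symbol_dwE//.
have [bz bw] := (disk_bounded_cauchy Dz, disk_bounded_cauchy Dw).
have bzz := disk_boundedM bz bz; have bww := disk_boundedM bw bw.
have bA := disk_boundedM bzz (disk_bounded_id_cauchy Dw).
have bB := disk_bounded_symbol_kernel_dw Dz Dw.
have bzA := disk_boundedM (disk_bounded_cst (z ^+ 2)) bA.
have bwB := disk_boundedM (disk_bounded_cst (- w ^+ 2)) bB.
rewrite -mulNr -(mu_integralZ mmu mu_le1 _ (disk_boundedM bzz bww)).
rewrite -(mu_integralZ mmu mu_le1 _ bA) -(mu_integralZ mmu mu_le1 _ bB).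
rewrite -(mu_integralD mmu mu_le1 bzA bwB).
(* Up to the factor zw u_z^2 u_w^2 the integrands agree because z (1 - w conj x) - w (1 - z conj x)
   = z - w. *)
apply: eq_mu_integral => x Dx; rewrite /symbol_kernel_dw /cauchy_kernel.
by field; rewrite !cauchy_den_neq0.
Qed.

End MultiplicationSymbol.

(** As [derive1] is total, holomorphy of [Q] and of [d_w Q] certifies that the derivatives in the
    equation are genuine. *)
Theorem theorem2p7 (R : realType) (mu : Cplx R -> Cplx R)
    (mmu : disk_measurable mu) (mu_le1 : (Linfty_norm mu <= 1)%E) :
  let Q := dirichlet_symbol (mulop mu) in
  [/\ forall z w, disk z -> disk w -> Q z 0 = 0 /\ Q 0 w = 0,
      holomorphic_bidisk Q,
      holomorphic_bidisk (d_w Q) &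
      forall z w, disk z -> disk w ->
        z * w * (z - w) * d_z (d_w Q) z w =
        z ^+ 2 * d_z Q z w - w ^+ 2 * d_w Q z w].
Proof.
split=> [z w _ _|[z w] /= Dz Dw|[z w] /= Dz Dw|z w Dz Dw].
- by rewrite /dirichlet_symbol mulr0 !mul0r.
- by have [] := is_diff_symbol mmu mu_le1 Dz Dw.
- by have [b []] := is_diff_symbol_dw mmu mu_le1 Dz Dw.
- exact: symbol_wave_equation.
Qed.
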